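(* For a finite-dimensional complex evolution algebra $E$ the following are equivalent: $E$ is nil; $E$ is nilpotent; $E$ is right nilpotent. However, the indexes of nility, right nilpotency and nilpotency do not coincide in general, i.e. there exists a finite-dimensional nilpotent complex evolution algebra for which these three indexes are not all equal.
   Context: An evolution algebra over a field $K$ is a vector space $E$ over $K$ with a bilinear multiplication and a basis $\{e_1,e_2,\dots\}$ (called a natural basis) such that $e_ie_j=0$ for $i\neq j$ and $e_ie_i=\sum_k a_{ik}e_k$; here $K=\mathbb{C}$. Put $E^{<1>}=E$, $E^{<k+1>}=E^{<k>}E$; $E^1=E$, $E^k=\sum_{i=1}^{k-1}E^iE^{k-i}$ for $k\ge2$ (products of subspaces are linear spans of products). $E$ is right nilpotent (resp. nilpotent) if $E^{<m>}=0$ (resp. $E^m=0$) for some $m\in\mathbb{N}$, and the minimal such $m$ is the index of right nilpotency (resp. nilpotency). An element $a\in E$ is nil if there is $m=n(a)\in\mathbb{N}$ with $(\dots((a\cdot a)\cdot a)\cdots)\cdot a=0$ ($m$ factors $a$); $E$ is nil if all its elements are nil. The index of nility of $E$ is the minimal $m$ such that the product of $m$ factors $(\dots((a\cdot a)\cdot a)\cdots)\cdot a$ vanishes for every $a\in E$. *)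

(* Defs.v *)
From mathcomp Require Import all_boot all_order all_algebra.

Set Implicit Arguments.
Unset Strict Implicit.
Unset Printing Implicit Defensive.

Import GRing.Theory.
Local Open Scope ring_scope.

Section NonassociativeAlgebra.

(* The multiplication is not assumed associative or unital, so falgType and
   its product of subspaces do not apply. *)
Variables (K : fieldType) (E : vectType K) (mul : {bilinear E -> E -> E}).

Definition natural_basis (n : nat) (e : n.-tuple E) (a : 'M[K]_n) : Prop :=
  [/\ basis_of fullv e,
      forall i j : 'I_n, i != j -> mul e`_i e`_j = 0
    & forall i : 'I_n, mul e`_i e`_i = \sum_(k < n) a i k *: e`_k].

Definition is_evolution_algebra : Prop :=
  exists (n : nat) (e : n.-tuple E) (a : 'M[K]_n), natural_basis e a.

(* Bases suffice by bilinearity; see memv_prodsp and prodspP. *)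
Definition prodsp (U V : {vspace E}) : {vspace E} :=
  <<[seq mul u v | u <- vbasis U, v <- vbasis V]>>%VS.

Lemma memv_prodsp (U V : {vspace E}) (u v : E) :
  u \in U -> v \in V -> mul u v \in prodsp U V.
Proof.
move=> /coord_vbasis-> /coord_vbasis->.
rewrite linear_sumlz; apply: memv_suml => i _ /=.
rewrite linear_sumr; apply: memv_suml => j _ /=.
rewrite linearZl_LR linearZr_LR !memvZ // memv_span //.
by apply/allpairsP; exists ((vbasis U)`_i, (vbasis V)`_j); rewrite !memt_nth.
Qed.

Lemma prodspP (U V W : {vspace E}) :
  (prodsp U V <= W)%VS <->
  (forall u v : E, u \in U -> v \in V -> mul u v \in W).
Proof.
split=> [sUVW u v Uu Vv | sUVW].
  by rewrite (subvP sUVW) ?memv_prodsp.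
apply/span_subvP=> _ /allpairsP[[u v] /= [Uu Vv ->]].
by rewrite sUVW ?vbasis_mem.
Qed.

(* E^<k>, meaningful for 0 < k. *)
Definition right_power (k : nat) : {vspace E} :=
  iter k.-1 (fun U => prodsp U fullv) fullv.

(* The list E^0, E^1, ..., E^(n+1), with a junk entry E^0, from which the
   course-of-values recursion for E^k is read off (see algebra_powerE). *)
Fixpoint algebra_powers (n : nat) : seq {vspace E} :=
  if n is n'.+1 then
    let s := algebra_powers n' in
    rcons s (\sum_(1 <= i < n'.+2)
               prodsp (nth fullv s i) (nth fullv s (n'.+2 - i)))%VS
  else [:: fullv; fullv].

(* E^k, meaningful for 0 < k. *)
Definition algebra_power (k : nat) : {vspace E} :=
  nth fullv (algebra_powers k) k.

Lemma size_algebra_powers (n : nat) : size (algebra_powers n) = n.+2.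
Proof. by elim: n => //= n IHn; rewrite size_rcons IHn. Qed.

Lemma nth_algebra_powers (n k : nat) :
  (k <= n.+1)%N -> nth fullv (algebra_powers n) k = algebra_power k.
Proof.
have stable m i : (i <= m.+1)%N ->
    nth fullv (algebra_powers m.+1) i = nth fullv (algebra_powers m) i.
  by move=> le_im; rewrite /= nth_rcons size_algebra_powers ltnS le_im.
have up m i d : (i <= m.+1)%N ->
    nth fullv (algebra_powers (d + m)) i = nth fullv (algebra_powers m) i.
  move=> le_im; elim: d => // d IHd; rewrite addSn stable ?IHd //.
  by rewrite (leq_trans le_im) // ltnS leq_addl.
move=> le_kn; have [le_nk | lt_kn] := leqP n k.
  by rewrite /algebra_power -(subnK le_nk) up // subnK.
by rewrite /algebra_power -(subnK (ltnW lt_kn)) up // leqnSn.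
Qed.

Lemma algebra_power1 : algebra_power 1 = fullv.
Proof. by []. Qed.

Lemma algebra_powerE (k : nat) : (1 < k)%N ->
  algebra_power k =
    (\sum_(1 <= i < k) prodsp (algebra_power i) (algebra_power (k - i)))%VS.
Proof.
case: k => [|[|k]] // _.
rewrite -(@nth_algebra_powers k.+1 k.+2) //=.
rewrite nth_rcons size_algebra_powers ltnn eqxx.
apply: eq_big_nat => i /andP[i_gt0 lt_ik].
rewrite !nth_algebra_powers //.
by rewrite leq_subLR -add1n leq_add2r.
Qed.

(* ((a a) a) ... a with m factors, meaningful for 0 < m. *)
Definition element_power (a : E) (m : nat) : E :=
  iter m.-1 (fun x => mul x a) a.

Definition nil_element (a : E) : Prop :=
  exists m : nat, (0 < m)%N /\ element_power a m = 0.

Definition nil_algebra : Prop := forall a : E, nil_element a.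

Definition nilpotent_algebra : Prop :=
  exists m : nat, (0 < m)%N /\ algebra_power m = 0%VS.

Definition right_nilpotent_algebra : Prop :=
  exists m : nat, (0 < m)%N /\ right_power m = 0%VS.

Definition least_positive (P : nat -> Prop) (m : nat) : Prop :=
  [/\ (0 < m)%N, P m & forall k : nat, (0 < k)%N -> P k -> (m <= k)%N].

Definition nility_index : nat -> Prop :=
  least_positive (fun m => forall a : E, element_power a m = 0).

Definition nilpotency_index : nat -> Prop :=
  least_positive (fun m => algebra_power m = 0%VS).

Definition right_nilpotency_index : nat -> Prop :=
  least_positive (fun m => right_power m = 0%VS).

End NonassociativeAlgebra.

(* Main.v *)
Require Import Defs.
From HB Require Import structures.
From mathcomp Require Import all_boot all_order all_algebra.
From mathcomp Require Import reals complex.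

Set Implicit Arguments.
Unset Strict Implicit.
Unset Printing Implicit Defensive.

Import GRing.Theory.
Local Open Scope ring_scope.

(** In every algebra [E^<k>] is contained in [E^k] and contains the k-th power of
    each element, so nilpotency implies right nilpotency, which implies nility.
    What remains is that a nil evolution algebra is nilpotent, over any field.

    Draw an arrow from [i] to [k] when [e_k] occurs in [e_i e_i]. The elements of
    [E^<t+1>] are supported at the ends of paths of length [t]
    ([coord_right_power]), so the algebra is right nilpotent as soon as the graph
    has no cycle. If there are cycles, take a chordless one, as a minimal
    nonempty set of vertices each having a predecessor in it
    ([minimal_cycle]). Multiplying on the right by the sum [x] of its basis
    vectors permutes the coordinates along the cycle up to nonzero factors, so no
    power of [x] vanishes ([nil_evolution_acyclic]). Finally, evolution algebras
    are commutative, and in a commutative algebra [E^k] is contained in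
    [E^<t+2>] whenever [2^t < k] ([algebra_power_sub_right_power]), so right
    nilpotency gives nilpotency.

    The indexes differ for the chain [e_0 e_0 = e_1], [e_1 e_1 = e_2],
    [e_2 e_2 = 0]: nility and right nilpotency have index 4, since the third
    power of [e_0 + e_1] is [e_2] and [E^<4> = 0], but
    [e_2 = (e_0 e_0)(e_0 e_0)] is in [E^4], so the index of nilpotency is 5. *)

(** * Powers in a nonassociative algebra *)

Section Powers.

Variables (K : fieldType) (E : vectType K) (mul : {bilinear E -> E -> E}).

Lemma right_powerS (t : nat) :
  right_power mul t.+2 = prodsp mul (right_power mul t.+1) fullv.
Proof. by []. Qed.

Lemma element_powerS (x : E) (t : nat) :
  element_power mul x t.+2 = mul (element_power mul x t.+1) x.
Proof. by []. Qed.

Lemma mem_element_power_right_power (x : E) (k : nat) :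
  element_power mul x k \in right_power mul k.
Proof.
case: k => [|k]; first exact: memvf.
elim: k => [|k IHk]; first exact: memvf.
by rewrite element_powerS right_powerS memv_prodsp ?memvf.
Qed.

Lemma element_power_eq0 (x : E) (k : nat) :
  right_power mul k = 0%VS -> element_power mul x k = 0.
Proof.
by move=> Ek0; apply/eqP; rewrite -memv0 -Ek0 mem_element_power_right_power.
Qed.

Lemma element_power_eq0_leq (x : E) (k m : nat) :
    (0 < k)%N -> (k <= m)%N ->
  element_power mul x k = 0 -> element_power mul x m = 0.
Proof.
case: k => // k _ /subnKC <-; elim: (m - k.+1)%N => [|d IHd] xk0.
  by rewrite addn0.
by rewrite addnS addSn element_powerS -addSn IHd // linear0l.
Qed.

Lemma prodsp_algebra_power (i j : nat) : (0 < i)%N -> (0 < j)%N ->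
  (prodsp mul (algebra_power mul i) (algebra_power mul j)
     <= algebra_power mul (i + j))%VS.
Proof.
move=> i_gt0 j_gt0.
have lt_i : (i < i + j)%N by rewrite -[X in (X < _)%N]addn0 ltn_add2l.
rewrite [in X in (_ <= X)%VS]algebra_powerE; last exact: leq_trans lt_i.
rewrite (big_cat_nat _ (ltnW lt_i)) //= [X in (_ <= _ + X)%VS]big_ltn //.
by rewrite addKn; apply: subv_trans (addvSr _ _); apply: addvSl.
Qed.

Lemma right_power_sub_algebra_power (k : nat) :
  (0 < k)%N -> (right_power mul k <= algebra_power mul k)%VS.
Proof.
case: k => // k _; elim: k => [|k IHk]; first exact: subvf.
rewrite right_powerS; apply/prodspP => u v Eu _.
have /subvP := prodsp_algebra_power (ltn0Sn k) (ltn0Sn 0); rewrite addn1; apply.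
by rewrite memv_prodsp ?memvf // (subvP IHk).
Qed.

(** When [2^(t+1) < k], one of the two factors of a product in [E^i E^(k-i)] has
    an exponent larger than [2^t], and by commutativity it can be taken to be
    the left one: each doubling of the exponent gains one right
    multiplication. *)
Lemma algebra_power_sub_right_power (t k : nat) :
    commutative mul -> (2 ^ t < k)%N ->
  (algebra_power mul k <= right_power mul t.+2)%VS.
Proof.
move=> mulC; elim: t k => [|t IHt] k lt_tk.
all: have k_gt1 : (1 < k)%N by apply: leq_ltn_trans lt_tk; rewrite expn_gt0.
all: rewrite algebra_powerE // big_nat; elim/big_ind: _ => [|U V sU sV|i lt_ik].
1,4: exact: sub0v.
1,3: by rewrite subv_add sU.
all: rewrite right_powerS; apply/prodspP => u v Eu Ev.
  by rewrite memv_prodsp ?memvf.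
have [lt_ti|le_it] := ltnP (2 ^ t) i.
  by rewrite memv_prodsp ?memvf // (subvP (IHt i lt_ti)).
rewrite mulC memv_prodsp ?memvf // (subvP (IHt (k - i)%N _)) //.
by rewrite ltn_subRL (leq_ltn_trans _ lt_tk) // expnS mul2n -addnn leq_add2r.
Qed.

End Powers.

(** * Supports in an evolution algebra *)

Section Supports.

Variables (n : nat) (K : fieldType) (a : 'M[K]_n).
Implicit Types X S : {set 'I_n}.

(** The successors of [X] in the directed graph on the natural basis with an
    arrow from [i] to [k] whenever [e_k] occurs in [e_i e_i]. *)
Definition successors X : {set 'I_n} :=
  [set k | [exists i in X, a i k != 0]].

Lemma successorsP X k :
  reflect (exists2 i, i \in X & a i k != 0) (k \in successors X).
Proof. by rewrite inE; apply: exists_inP. Qed.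

Lemma successors_mono : {homo successors : X Y / X \subset Y}.
Proof.
move=> X Y sXY; apply/subsetP => k /successorsP[i Xi aik].
by apply/successorsP; exists i; rewrite ?(subsetP sXY).
Qed.

(** The [t]-th iterate of [successors] on the whole vertex set consists of the
    ends of paths of length [t]. After [n] steps the iterates have stabilized at
    the greatest fixpoint, which is contained in its own successors. *)
Lemma iter_successors_eq0 :
    (forall S, S \subset successors S -> S = set0) ->
  iter n successors setT = set0.
Proof.
move=> no_cycle.
have iterC m : iter m (funsetC successors) set0 = ~: iter m successors setT.
  by elim: m => [|m IHm] /=; rewrite ?setCT // IHm /funsetC setCK.
suff <- : cofixset successors = iter n successors setT.
  by apply: no_cycle; rewrite (cofixsetK successors_mono).
by rewrite /cofixset /fixset card_ord iterC setCK.
Qed.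

(** A minimal nonempty set contained in its own successors is a chordless
    cycle, so within it every vertex has exactly one predecessor. *)
Lemma minimal_cycle S0 : S0 != set0 -> S0 \subset successors S0 ->
  exists2 S, S != set0 & forall k, k \in S ->
    exists2 i, i \in S &
      a i k != 0 /\ (forall j, j \in S -> j != i -> a j k = 0).
Proof.
move=> nz_S0 sS0.
pose P S := (S != set0) && (S \subset successors S).
have [|S /minsetP[/andP[nz_S sS] minS] _] := @minset_exists _ P S0.
  by rewrite /P nz_S0.
exists S => //.
have succS k : k \in S -> exists2 i, i \in S & a i k != 0.
  by move=> Sk; apply/successorsP; apply: (subsetP sS).
(* By minimality, removing [i] from [S] leaves a vertex all of whose
   predecessors in [S] are equal to [i]; the vertex is [i] itself when nothing
   else is left. *)
have only_pred i : exists m, i \in S ->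
    m \in S /\ (a i m != 0 /\ (forall j, j \in S -> j != i -> a j m = 0)).
  have [Si|] := boolP (i \in S); last by exists i.
  suff [m Sm m_pred] :
      exists2 m, m \in S & forall j, j \in S -> j != i -> a j m = 0.
    exists m => _; split=> //; split=> //.
    have [j Sj nz_ajm] := succS m Sm; have [<- // | ne_ji] := eqVneq j i.
    by rewrite m_pred ?eqxx in nz_ajm.
  have [S'0|nz_S'] := eqVneq (S :\ i) set0.
    exists i => // j Sj ne_ji.
    by have := in_set0 j; rewrite -S'0 !inE ne_ji Sj.
  have /subsetPn[m] : ~~ (S :\ i \subset successors (S :\ i)).
    apply/negP => sS'; have eqS : S :\ i = S.
      by apply: minS; rewrite ?subD1set // /P nz_S'.
    by move: Si; rewrite -eqS !inE eqxx.
  rewrite !inE => /andP[_ Sm] /exists_inPn m_pred; exists m => // j Sj ne_ji.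
  by apply/eqP; rewrite -[_ == _]negbK m_pred // !inE ne_ji.
(* [i] is the only predecessor of [g i] in [S], so [g] is injective on [S], hence
   onto [S], and every vertex of [S] is some [g i]. *)
have [g gP] := fin_all_exists only_pred.
have g_inj : {in S &, injective g}.
  move=> i j Si Sj eq_g; have [_ [nz_i _]] := gP i Si.
  apply/eqP; apply: contraNT nz_i => ne_ij.
  by have [_ [_ gj_pred]] := gP j Sj; rewrite eq_g gj_pred.
have gS : g @: S = S.
  apply/eqP; rewrite eqEcard card_in_imset ?leqnn // andbT.
  by apply/subsetP => _ /imsetP[i Si ->]; have [] := gP i Si.
move=> k; rewrite -{1}gS => /imsetP[i Si ->]; exists i => //.
by have [] := gP i Si.
Qed.

End Supports.

Section EvolutionAlgebra.

Variables (K : fieldType) (E : vectType K) (mul : {bilinear E -> E -> E}).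
Variables (n : nat) (e : n.-tuple E) (a : 'M[K]_n).
Hypothesis e_nat : natural_basis mul e a.

Lemma coord_mul (x y : E) (k : 'I_n) :
  coord e k (mul x y) = \sum_i coord e i x * coord e i y * a i k.
Proof.
have [e_basis e_orth e_sqr] := e_nat.
rewrite {1}(coord_basis e_basis (memvf x)) linear_sumlz linear_sum.
apply: eq_bigr => i _.
rewrite {1}(coord_basis e_basis (memvf y)) linear_sumr (bigD1 i) //=.
rewrite big1 => [|j ne_ji]; last first.
  by rewrite linearZl_LR linearZr_LR e_orth ?scaler0 // eq_sym.
rewrite addr0 linearZl_LR linearZr_LR /= !linearZ /= -mulrA; congr (_ * (_ * _)).
by rewrite e_sqr coord_sum_free ?(basis_free e_basis).
Qed.

Lemma coord_inj (x y : E) : (forall k, coord e k x = coord e k y) -> x = y.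
Proof.
have [e_basis _ _] := e_nat => eq_xy.
rewrite (coord_basis e_basis (memvf x)) (coord_basis e_basis (memvf y)).
by apply: eq_bigr => k _; rewrite eq_xy.
Qed.

Lemma evolution_mulC : commutative mul.
Proof.
move=> x y; apply: coord_inj => k; rewrite !coord_mul.
by apply: eq_bigr => i _; rewrite [coord e i x * _]mulrC.
Qed.

(** The coordinates of an element of [E^<t+1>] are supported at the ends of
    paths of length [t]. *)
Lemma coord_right_power (t : nat) (x : E) (k : 'I_n) :
    x \in right_power mul t.+1 -> k \notin iter t (successors a) setT ->
  coord e k x = 0.
Proof.
pose W (X : {set 'I_n}) :=
  (\bigcap_(k | k \notin X) lker (linfun (coord e k : E -> K^o)))%VS.
have WP (X : {set 'I_n}) y :
    reflect (forall k, k \notin X -> coord e k y = 0) (y \in W X).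
  rewrite memvE; apply: (iffP subv_bigcapP) => Wy i Xi.
    by have := Wy i Xi; rewrite -memvE memv_ker lfunE => /eqP.
  by rewrite -memvE memv_ker lfunE /= Wy.
suff sW : (right_power mul t.+1 <= W (iter t (successors a) setT))%VS.
  by move=> /(subvP sW)/WP; apply.
elim: t => [|t IHt].
  by apply/subvP => y _; apply/WP => i; rewrite inE.
rewrite right_powerS; apply/prodspP => u v /(subvP IHt)/WP u0 _.
apply/WP => i /= Ni; rewrite coord_mul big1 // => j _.
have [aji0|nz_aji] := eqVneq (a j i) 0; first by rewrite aji0 mulr0.
have [Xj|/u0->] := boolP (j \in iter t (successors a) setT); last first.
  by rewrite !mul0r.
by case/successorsP: Ni; exists j.
Qed.

Lemma right_power_eq0 (t : nat) :
  iter t (successors a) setT = set0 -> right_power mul t.+1 = 0%VS.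
Proof.
move=> succ0; apply/eqP; rewrite -subv0; apply/subvP => x Ex.
rewrite memv0; apply/eqP/coord_inj => k.
by rewrite linear0 (coord_right_power Ex) // succ0 inE.
Qed.

(** The sum of the basis vectors of a chordless cycle is not nil: all its powers
    keep nonzero coordinates along the whole cycle. *)
Lemma nil_evolution_acyclic :
  nil_algebra mul -> forall S : {set 'I_n}, S \subset successors a S -> S = set0.
Proof.
move=> nilE S0 sS0; have [//|nz_S0] := eqVneq S0 set0.
have [S nz_S S_pred] := minimal_cycle nz_S0 sS0.
have e_free : free e by have [/basis_free] := e_nat.
pose x := \sum_(i in S) e`_i.
have coord_x k : k \in S -> coord e k x = 1.
  move=> Sk; rewrite linear_sum (bigD1 k) //= coord_free // eqxx.
  by rewrite big1 ?addr0 // => i /andP[_ /negPf ne_ik]; rewrite coord_free ?ne_ik.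
have nz_pow m k : k \in S -> coord e k (element_power mul x m.+1) != 0.
  elim: m k => [|m IHm] k Sk; first by rewrite coord_x ?oner_eq0.
  have [i Si [nz_aik aSk0]] := S_pred k Sk.
  rewrite element_powerS coord_mul (bigD1 i) //= big1 => [|j ne_ji].
    by rewrite addr0 coord_x // mulr1 mulf_neq0 ?IHm.
  have [Sj|S'j] := boolP (j \in S); first by rewrite aSk0 ?mulr0.
  suff -> : coord e j x = 0 by rewrite mulr0 mul0r.
  rewrite linear_sum big1 //= => l Sl; rewrite coord_free //.
  by have [eq_lj|//] := eqVneq l j; rewrite -eq_lj Sl in S'j.
have [m [m_gt0 xm0]] := nilE x.
have /set0Pn[k Sk] := nz_S.
by have := nz_pow m.-1 k Sk; rewrite prednK // xm0 linear0 eqxx.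
Qed.

Lemma nil_evolution_right_nilpotent :
  nil_algebra mul -> right_power mul n.+1 = 0%VS.
Proof.
by move/nil_evolution_acyclic/iter_successors_eq0; apply: right_power_eq0.
Qed.

End EvolutionAlgebra.

Lemma evolution_algebra_tfae (K : fieldType) (E : vectType K)
    (mul : {bilinear E -> E -> E}) :
  is_evolution_algebra mul ->
  [<-> nil_algebra mul; nilpotent_algebra mul; right_nilpotent_algebra mul].
Proof.
move=> [n [e [a e_nat]]]; tfae.
- move/(nil_evolution_right_nilpotent e_nat) => En0; exists (2 ^ n).+1.
  split=> //; apply/eqP; rewrite -subv0.
  apply: subv_trans (algebra_power_sub_right_power (evolution_mulC e_nat) _) _.
    exact: ltnSn.
  rewrite right_powerS En0; apply/prodspP => u v; rewrite memv0 => /eqP-> _.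
  by rewrite linear0l mem0v.
- move=> [m [m_gt0 Em0]]; exists m; split=> //; apply/eqP.
  by rewrite -subv0 -Em0 right_power_sub_algebra_power.
- move=> [m [m_gt0 Em0]] x; exists m; split=> //.
  exact: element_power_eq0.
Qed.

(** * The evolution algebra of a matrix *)

Section MatrixEvolutionAlgebra.

Variables (K : fieldType) (n : nat) (a : 'M[K]_n).

(** The evolution algebra on row vectors whose natural basis is the canonical
    one, with structure constants given by the rows of [a]. *)
Definition evolution_mul (x y : 'rV[K]_n) : 'rV[K]_n :=
  \row_i (x 0 i * y 0 i) *m a.

Lemma evolution_mul_is_bilinear : bilinear_for *:%R *:%R evolution_mul.
Proof.
split=> z c x y /=; rewrite /evolution_mul scalemxAl -mulmxDl; congr (_ *m _);
  apply/rowP => i; rewrite !mxE.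
  by rewrite mulrDl mulrA.
by rewrite mulrDr mulrCA.
Qed.

HB.instance Definition _ :=
  bilinear_isBilinear.Build K 'rV[K]_n 'rV[K]_n 'rV[K]_n *:%R *:%R evolution_mul evolution_mul_is_bilinear.

Lemma evolution_mul_delta (i j : 'I_n) :
  evolution_mul (delta_mx 0 i) (delta_mx 0 j) = if i == j then row i a else 0.
Proof.
have -> : evolution_mul (delta_mx 0 i) (delta_mx 0 j) =
          ((i == j)%:R *: delta_mx 0 i) *m a.
  congr (_ *m _); apply/rowP => k; rewrite !mxE /=.
  have [->|_] := eqVneq k i; last by rewrite mul0r mulr0.
  by rewrite mul1r mulr1.
rewrite -scalemxAl -rowE; case: eqP => _; first by rewrite scale1r.
by rewrite scale0r.
Qed.

(** The canonical basis of row vectors. *)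
Definition delta_basis : n.-tuple 'rV[K]_n := [tuple delta_mx 0 i | i < n].

Lemma nth_delta_basis (i : 'I_n) : delta_basis`_i = delta_mx 0 i.
Proof. by rewrite -tnth_nth tnth_mktuple. Qed.

Lemma delta_basisP : basis_of fullv delta_basis.
Proof.
have dimE : \dim {:'rV[K]_n} = n by rewrite dimvf; apply: mul1n.
rewrite basisEdim dimE size_tuple leqnn andbT.
apply/subvP => x _; rewrite [x]row_sum_delta; apply: memv_suml => i _.
by rewrite memvZ // memv_span // -nth_delta_basis mem_nth ?size_tuple.
Qed.

Lemma evolution_mul_natural_basis : natural_basis evolution_mul delta_basis a.
Proof.
split=> [|i j ne_ij|i]; first exact: delta_basisP.
  by rewrite !nth_delta_basis [LHS]evolution_mul_delta (negPf ne_ij).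
rewrite nth_delta_basis [LHS]evolution_mul_delta eqxx [LHS]row_sum_delta.
by apply: eq_bigr => k _; rewrite nth_delta_basis mxE.
Qed.

End MatrixEvolutionAlgebra.

(** * An algebra with distinct indices *)

Section Chain.

Variable K : fieldType.

(** The structure constants of the evolution algebra with [e_0 e_0 = e_1],
    [e_1 e_1 = e_2] and [e_2 e_2 = 0]. *)
Definition chain_matrix : 'M[K]_3 := \matrix_(i, k) (k == i.+1 :> nat)%:R.

Let mul : {bilinear 'rV[K]_3 -> 'rV[K]_3 -> 'rV[K]_3} :=
  evolution_mul chain_matrix.
Let e (i : 'I_3) : 'rV[K]_3 := delta_mx 0 i.

Lemma chain_mul i j : mul (e i) (e j) = if i == j then row i chain_matrix else 0.
Proof. exact: evolution_mul_delta. Qed.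

Lemma row_chain (i k : 'I_3) : k = i.+1 :> nat -> row i chain_matrix = e k.
Proof. by move=> ik; apply/rowP => l; rewrite !mxE -ik. Qed.

Lemma chain_right_power4 : right_power mul 4 = 0%VS.
Proof.
apply: (right_power_eq0 (evolution_mul_natural_basis _)).
apply/setP => k; rewrite [RHS]in_set0; apply/negP.
(* An arrow raises the index by one, so a path of length [t] ends at an index
   at least [t]. *)
suff len t i : i \in iter t (successors chain_matrix) setT -> (t <= i)%N.
  by move/len; rewrite leqNgt ltn_ord.
elim: t i => // t IHt i /= /successorsP[j /IHt le_tj].
by rewrite mxE; have [->|_] := eqVneq (i : nat) j.+1; rewrite ?eqxx.
Qed.

Lemma chain_mul_neq i j : i != j -> mul (e i) (e j) = 0.
Proof. by rewrite chain_mul => /negPf->. Qed.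

Lemma chain_mul00 : mul (e 0) (e 0) = e 1.
Proof. by rewrite chain_mul eqxx (@row_chain 0 1). Qed.

Lemma chain_mul11 : mul (e 1) (e 1) = e 2.
Proof. by rewrite chain_mul eqxx (@row_chain 1 2). Qed.

Lemma chain_e2_neq0 : e 2 != 0.
Proof.
by apply/eqP => /rowP/(_ 2) /eqP; rewrite !mxE !eqxx oner_eq0.
Qed.

Lemma chain_element_power3 : element_power mul (e 0 + e 1) 3 = e 2.
Proof.
rewrite !element_powerS.
have -> : mul (e 0 + e 1) (e 0 + e 1) = e 1 + e 2.
  rewrite linearDl !linearD /= chain_mul00 chain_mul11.
  by rewrite !chain_mul_neq // addr0 add0r.
rewrite linearDl !linearD /= chain_mul11.
by rewrite !chain_mul_neq // !addr0 add0r.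
Qed.

Lemma chain_element_power_neq0 k : (0 < k)%N -> (k <= 3)%N ->
  element_power mul (e 0 + e 1) k <> 0.
Proof.
move=> k_gt0 le_k3 /(element_power_eq0_leq k_gt0 le_k3).
by rewrite chain_element_power3; apply/eqP/chain_e2_neq0.
Qed.

Lemma chain_right_power_neq0 k : (0 < k)%N -> (k <= 3)%N ->
  right_power mul k <> 0%VS.
Proof.
move=> k_gt0 /(chain_element_power_neq0 k_gt0) nz_k.
by move/element_power_eq0.
Qed.

Lemma chain_nility_index : nility_index mul 4.
Proof.
split=> // [x|k k_gt0 k_nil].
  exact: element_power_eq0 chain_right_power4.
rewrite ltnNge; apply/negP => le_k3.
exact: chain_element_power_neq0 (k_nil _).
Qed.

Lemma chain_right_nilpotency_index : right_nilpotency_index mul 4.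
Proof.
split=> // [|k k_gt0 Ek0]; first exact: chain_right_power4.
by rewrite ltnNge; apply/negP => /(chain_right_power_neq0 k_gt0).
Qed.

(** [E^4] contains [E^2 E^2], hence [(e_0 e_0)(e_0 e_0) = e_2], although
    [E^<4> = 0]. *)
Lemma chain_nilpotency_index : nilpotency_index mul 5.
Proof.
split=> // [|k k_gt0 Ek0].
  apply/eqP; rewrite -subv0 -chain_right_power4.
  apply: algebra_power_sub_right_power => //.
  exact: evolution_mulC (evolution_mul_natural_basis _).
rewrite ltnNge leq_eqVlt; apply/negP => /predU1P[k4|/= le_k3].
  have E2_e1 : e 1 \in algebra_power mul 2.
    rewrite -chain_mul00; have /subvP := @prodsp_algebra_power _ _ mul 1 1 isT isT.
    by apply; rewrite memv_prodsp ?memvf.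
  have /subvP/(_ (e 2)) := @prodsp_algebra_power _ _ mul 2 2 isT isT.
  rewrite -{1}chain_mul11 memv_prodsp // -[(2 + 2)%N]k4 Ek0 memv0.
  by rewrite (negPf chain_e2_neq0) => /(_ isT).
apply: (chain_right_power_neq0 k_gt0 le_k3); apply/eqP.
by rewrite -subv0 -Ek0 right_power_sub_algebra_power.
Qed.

End Chain.

Theorem corollary4p6 (R : realType) :
  (forall (E : vectType R[i]) (mul : {bilinear E -> E -> E}),
     is_evolution_algebra mul ->
     [<-> nil_algebra mul; nilpotent_algebra mul; right_nilpotent_algebra mul])
  /\
  (exists (E : vectType R[i]) (mul : {bilinear E -> E -> E}),
     is_evolution_algebra mul /\ nilpotent_algebra mul /\
     exists n_nil n_right n_nilp : nat,
       [/\ nility_index mul n_nil,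
           right_nilpotency_index mul n_right,
           nilpotency_index mul n_nilp
         & ~ (n_nil = n_right /\ n_right = n_nilp)]).
Proof.
split=> [E mul|]; first exact: evolution_algebra_tfae.
pose mul : {bilinear 'rV[R[i]]_3 -> 'rV[R[i]]_3 -> 'rV[R[i]]_3} :=
  evolution_mul (chain_matrix R[i]).
exists 'rV[R[i]]_3, mul; split; last split.
- exists 3, (delta_basis _ 3), (chain_matrix _).
  exact: evolution_mul_natural_basis.
- by exists 5; have [] := chain_nilpotency_index R[i].
- exists 4, 4, 5; split=> [|||[]] //.
  + exact: chain_nility_index.
  + exact: chain_right_nilpotency_index.
  + exact: chain_nilpotency_index.
Qed.
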